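(* For every positive integer $k$ and every integer $q$ with $|q|\le 2^k$, there is a connected finite simple graph $G$ with $\phi(G)=k$ and $I(G;-1)=q$.
   Context: All graphs are finite and simple. For a graph $G$, the independence polynomial is $I(G;x)=\sum_{j=0}^{\alpha(G)} s_j x^j$, where $s_j$ is the number of independent sets of size $j$ in $G$ (so $s_0=1$, counting the empty set) and $\alpha(G)$ is the maximum size of an independent set. The decycling number $\phi(G)$ is the minimum size of a set $S\subseteq V(G)$ such that $G-S$ is acyclic. *)

(* Defs.v *)
From HB Require Import structures.
From mathcomp Require Import all_boot all_order all_algebra.

Set Implicit Arguments.
Unset Strict Implicit.
Unset Printing Implicit Defensive.

Import GRing.Theory.
Local Open Scope ring_scope.

Record sgraph := SGraph {
  vertex :> finType;
  adj : rel vertex;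
  adj_sym : symmetric adj;
  adj_irr : irreflexive adj }.

Definition connected (G : sgraph) : Prop :=
  (0 < #|G|)%N /\ forall x y : G, connect (@adj G) x y.

Section Induced.
Variables (G : sgraph) (A : {set G}).

Definition induced_adj : rel {x : G | x \in A} :=
  fun u v => adj (val u) (val v).

Lemma induced_adj_sym : symmetric induced_adj.
Proof. by move=> u v; apply: adj_sym. Qed.

Lemma induced_adj_irr : irreflexive induced_adj.
Proof. by move=> u; apply: adj_irr. Qed.

Definition induced : sgraph := SGraph induced_adj_sym induced_adj_irr.
End Induced.

(* A cycle is a duplicate-free cyclic sequence of at least three vertices:
   [ucycleb] alone also accepts [::] and the two ends of an edge. The length
   bound #|G| loses nothing and makes the predicate decidable, see [acyclicP]. *)
Definition acyclic (G : sgraph) : bool :=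
  [forall n : 'I_#|G|.+1, forall c : n.-tuple G,
     ucycleb (@adj G) c ==> (n < 3)%N].

Lemma acyclicP (G : sgraph) :
  reflect (forall c : seq G, ucycle (@adj G) c -> (size c < 3)%N) (acyclic G).
Proof.
apply: (iffP forallP) => [acG c cyc | acG n].
  have /andP[_ uc] := cyc.
  have lec : (size c < #|G|.+1)%N.
    by rewrite ltnS -(card_uniqP uc) max_card.
  by have /forallP/(_ (in_tuple c))/implyP/(_ cyc) := acG (Ordinal lec).
apply/forallP => c; apply/implyP => cyc.
by rewrite -[X in (X < _)%N](size_tuple c); apply: acG.
Qed.

Definition decycling (G : sgraph) (S : {set G}) : bool :=
  acyclic (induced (~: S)).

Lemma decyclingT (G : sgraph) : decycling [set: G].
Proof.
apply/acyclicP => -[//|[x xP] c] _.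
by exfalso; move: xP; rewrite setCT inE.
Qed.

Definition decycling_number (G : sgraph) : nat :=
  #|[arg min_(S < [set: G] | decycling S) #|S| ]|.

Lemma decycling_numberP (G : sgraph) (k : nat) :
  decycling_number G = k <->
  (exists2 S : {set G}, decycling S & #|S| = k) /\
  (forall S : {set G}, decycling S -> (k <= #|S|)%N).
Proof.
rewrite /decycling_number; case: arg_minnP => [|S dS minS].
  exact: decyclingT.
split=> [<- | [[S' dS' <-] minS']]; first by split=> //; exists S.
by apply/eqP; rewrite eqn_leq minS // minS'.
Qed.

Definition independent (G : sgraph) (A : {set G}) : bool :=
  [forall x in A, forall y in A, ~~ adj x y].

Definition indep_count (G : sgraph) (j : nat) : nat :=
  #|[set A : {set G} | independent A & #|A| == j]|.

Definition indep_number (G : sgraph) : nat :=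
  \max_(A : {set G} | independent A) #|A|.

Definition indep_poly (G : sgraph) : {poly int} :=
  \sum_(j < (indep_number G).+1) (indep_count G j)%:R *: 'X^j.

(* Main.v *)
(** For a rooted graph with root [r], let [b] and [c] be the values of the
    independence polynomial at [-1] after deleting [r], respectively the closed
    neighbourhood of [r]; the whole graph has the value [b - c]. Hanging the
    root below a new root maps [(b, c)] to [(b - c, b)], whose cube is [-1], and
    identifying two roots multiplies the pairs coordinatewise. A triangle with a
    pendant root realizes [(-2, -1)], so with [k] disjoint triangles the pairs
    [(m, -1)], [0 <= m < 2 ^ k], arise by following the binary digits of [m].
    All the graphs are trees of triangles, whose decycling number is the number
    of triangles. *)
Require Import Defs.
From HB Require Import structures.
From mathcomp Require Import all_boot all_order all_algebra.
From mathcomp Require Import zify ring.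

Set Implicit Arguments.
Unset Strict Implicit.
Unset Printing Implicit Defensive.

Import Order.TTheory GRing.Theory Num.Theory.
Local Open Scope ring_scope.

(** * The independence polynomial at -1 as a signed sum *)

(** This is the independence polynomial at -1 of the subgraph induced on [P], expressed with sets of
    [G] so that vertex deletions need no change of graph. *)
Definition alt_sum (G : sgraph) (P : {set G}) : int :=
  \sum_(A : {set G} | independent A && (A \subset P)) (-1) ^+ #|A|.

Lemma indepP (G : sgraph) (A : {set G}) :
  reflect {in A &, forall x y, ~~ adj x y} (independent A).
Proof.
apply: (iffP forall_inP) => [iA x y xA yA | iA x xA].
  by have /forall_inP := iA x xA; apply.
by apply/forall_inP => y yA; apply: iA.
Qed.

Lemma indep_poly_at_m1 (G : sgraph) :
  (indep_poly G).[-1] = alt_sum [set: G].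
Proof.
rewrite /indep_poly horner_sum /alt_sum.
(* Sets are grouped by size; [inord] keeps the size intact because an independent set has at most
   [indep_number G] elements. *)
rewrite (partition_big (fun A : {set G} => inord #|A| : 'I_(indep_number G).+1)
  xpredT) //=.
apply: eq_bigr => j _; rewrite hornerZ hornerXn.
have cardA (A : {set G}) : independent A ->
    ((inord #|A| : 'I_(indep_number G).+1) == j) = (#|A| == j).
  move=> iA; rewrite -val_eqE /= inordK // ltnS.
  exact: (@leq_bigmax_cond _ (@independent G) (fun A : {set G} => #|A|)).
rewrite mulr_natl -sumr_const; apply: eq_big => A.
  rewrite !inE subsetT andbT.
  by case iA: (independent A) => //=; rewrite cardA.
by rewrite inE => /andP[_ /eqP->].
Qed.

(** * Adding one vertex with a prescribed neighbourhood *)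

Section Cone.
Variables (G : sgraph) (N : {set G}).

Definition cone_adj : rel (option G) := fun u v =>
  match u, v with
  | Some x, Some y => adj x y
  | Some x, None | None, Some x => x \in N
  | None, None => false
  end.

Lemma cone_adj_sym : symmetric cone_adj.
Proof. by move=> [x|] [y|] //=; apply: adj_sym. Qed.

Lemma cone_adj_irr : irreflexive cone_adj.
Proof. by move=> [x|] //=; apply: adj_irr. Qed.

Definition cone : sgraph := SGraph cone_adj_sym cone_adj_irr.

Definition cone_set (u : bool * {set G}) : {set cone} :=
  [set o | if o is Some x then x \in u.2 else u.1].

Lemma cone_set_bij : bijective cone_set.
Proof.
exists (fun A : {set cone} => (None \in A, [set x | Some x \in A])).
  by move=> [b A]; rewrite inE; congr (_, _); apply/setP=> x; rewrite !inE.
by move=> A; apply/setP => -[x|]; rewrite !inE.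
Qed.

Lemma card_cone_set b A : #|cone_set (b, A)| = (b + #|A|)%N.
Proof.
rewrite (cardsD1 None) inE -(card_imset A Some_inj).
suff -> : cone_set (b, A) :\ None = Some @: A by [].
apply/setP=> -[x|]; rewrite !inE /=; first by rewrite (mem_imset _ _ Some_inj).
by symmetry; apply/imsetP => -[].
Qed.

Lemma indep_cone_set b A :
  independent (cone_set (b, A)) = independent A && (b ==> (A \subset ~: N)).
Proof.
apply/indepP/andP => [iA | [/indepP iA bA]].
  split; first by apply/indepP => x y xA yA; apply: (iA (Some x) (Some y)); rewrite inE.
  apply/implyP => bT; apply/subsetP => x xA; rewrite inE.
  by apply: (iA None (Some x)); rewrite inE.
move=> [x|] [y|]; rewrite !inE //=; first exact: iA.
  by move=> xA bT; move: bA; rewrite bT => /subsetP/(_ x xA); rewrite inE.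
by move=> bT yA; move: bA; rewrite bT => /subsetP/(_ y yA); rewrite inE.
Qed.

(** An independent set without the apex lives in [G]; one with the apex is an independent set
    avoiding [N] plus one vertex, which flips the sign. *)
Lemma alt_sum_cone :
  alt_sum [set: cone] = alt_sum [set: G] - alt_sum (~: N).
Proof.
rewrite {1}/alt_sum (reindex cone_set); last exact/onW_bij/cone_set_bij.
rewrite big_mkcond -(pair_bigA _ (fun b A => if independent (cone_set (b, A)) &&
  (cone_set (b, A) \subset [set: cone]) then (-1) ^+ #|cone_set (b, A)| else 0)) /=.
rewrite big_bool /= addrC; congr (_ + _).
  rewrite [RHS]big_mkcond /=; apply: eq_bigr => A _.
  by rewrite indep_cone_set card_cone_set !subsetT andbT.
rewrite /alt_sum [in RHS]big_mkcond /= -sumrN; apply: eq_bigr => A _.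
rewrite indep_cone_set card_cone_set subsetT andbT /=.
by case: ifP => _; rewrite ?oppr0 // add1n exprS mulN1r.
Qed.

Lemma alt_sum_cone_apex : alt_sum (~: [set None : cone]) = alt_sum [set: G].
Proof.
rewrite {1}/alt_sum (reindex cone_set); last exact/onW_bij/cone_set_bij.
rewrite big_mkcond -(pair_bigA _ (fun b A => if independent (cone_set (b, A)) &&
  (cone_set (b, A) \subset ~: [set None : cone])
  then (-1) ^+ #|cone_set (b, A)| else 0)) /=.
have subN b A : (cone_set (b, A) \subset ~: [set None : cone]) = ~~ b.
  by rewrite subsetC sub1set !inE.
rewrite big_bool /= big1 ?add0r => [|A _]; last by rewrite subN andbF.
rewrite /alt_sum [RHS]big_mkcond; apply: eq_bigr => A _.
by rewrite indep_cone_set card_cone_set subN subsetT /= !andbT.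
Qed.

End Cone.

(** * Disjoint unions *)

Section DisjointUnion.
Variables G H : sgraph.

Definition dunion_adj : rel (G + H)%type := fun u v =>
  match u, v with
  | inl x, inl y => adj x y
  | inr x, inr y => adj x y
  | _, _ => false
  end.

Lemma dunion_adj_sym : symmetric dunion_adj.
Proof. by move=> [x|x] [y|y] //=; apply: adj_sym. Qed.

Lemma dunion_adj_irr : irreflexive dunion_adj.
Proof. by move=> [x|x] /=; apply: adj_irr. Qed.

Definition dunion : sgraph := SGraph dunion_adj_sym dunion_adj_irr.

Definition dunion_set (u : {set G} * {set H}) : {set dunion} :=
  [set s | match s with inl x => x \in u.1 | inr y => y \in u.2 end].

Lemma dunion_set_bij : bijective dunion_set.
Proof.
exists (fun A : {set dunion} => ([set x | inl x \in A], [set y | inr y \in A])).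
  by move=> [A B]; congr (_, _); apply/setP=> x; rewrite !inE.
by move=> A; apply/setP => -[x|x]; rewrite !inE.
Qed.

Lemma card_dunion_set A B : #|dunion_set (A, B)| = (#|A| + #|B|)%N.
Proof.
rewrite -!sum1_card big_sumType /=.
by congr (_ + _)%N; apply: eq_bigl => x; rewrite inE.
Qed.

Lemma indep_dunion_set A B :
  independent (dunion_set (A, B)) = independent A && independent B.
Proof.
apply/indepP/andP => [iA | [/indepP iA /indepP iB]].
  split; apply/indepP => x y xA yA.
    by apply: (iA (inl x) (inl y)); rewrite inE.
  by apply: (iA (inr x) (inr y)); rewrite inE.
by move=> [x|x] [y|y]; rewrite !inE //=; [apply: iA | apply: iB].
Qed.

Lemma subset_dunion_set A B P Q :
  (dunion_set (A, B) \subset dunion_set (P, Q)) = (A \subset P) && (B \subset Q).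
Proof.
apply/subsetP/andP => [sAP | [/subsetP sAP /subsetP sBQ]].
  split; apply/subsetP => x xA.
    by have := sAP (inl x); rewrite !inE; apply.
  by have := sAP (inr x); rewrite !inE; apply.
by move=> [x|x]; rewrite !inE /=; [apply: sAP | apply: sBQ].
Qed.

Lemma alt_sum_dunion P Q :
  alt_sum (dunion_set (P, Q)) = alt_sum P * alt_sum Q.
Proof.
rewrite {1}/alt_sum (reindex dunion_set); last exact/onW_bij/dunion_set_bij.
rewrite /alt_sum big_distrlr /= pair_big /=.
apply: eq_big => [[A B]|[A B] _] /=.
  by rewrite indep_dunion_set subset_dunion_set andbACA.
by rewrite card_dunion_set exprD.
Qed.

End DisjointUnion.

(** * Upper and lower bounds on decycling sets *)

(** A rooted forest structure on [G - S]: [p] gives parents, [None] marks the roots, and [h]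
    decreases from child to parent. *)
Definition parent_certificate (G : sgraph) (S : {set G}) (p : G -> option G)
    (h : G -> nat) : Prop :=
  {in ~: S &, forall x y, adj x y -> (h y < h x)%N /\ p x = Some y \/
                                     (h x < h y)%N /\ p y = Some x}.

(* The highest vertex of a cycle would have two distinct parents, its
   neighbours along the cycle. *)
Lemma decycling_parent (G : sgraph) (S : {set G}) p h :
  parent_certificate S p h -> decycling S.
Proof.
move=> cert; apply/acyclicP => c cyc; rewrite ltnNge; apply/negP => sz3.
have [x0 x0c] : exists x, x \in c by case: c sz3 {cyc} => // x c _; exists x; rewrite mem_head.
have [x xc hmax] := arg_maxnP (fun u : induced (~: S) => h (val u)) x0c.
have [i c' rot_c] := rot_to xc.
have : ucycle (@induced_adj G (~: S)) (x :: c').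
  by rewrite -rot_c /ucycle rot_cycle rot_uniq.
have {}hmax y : y \in x :: c' -> (h (val y) <= h (val x))%N.
  by rewrite -rot_c mem_rot => /hmax.
have : (2 < size (x :: c'))%N by rewrite -rot_c size_rot.
case: c' {rot_c} hmax => [|y c'] //.
case/lastP: c' => [|c' z] // hmax _ /andP[/= /andP[xy]].
rewrite rcons_path last_rcons => /andP[_ zx] /and3P[_ yz _].
have p_x u : u \in x :: y :: rcons c' z -> adj (val x) (val u) ->
    p (val x) = Some (val u).
  move=> uc xu; have [[]//|[]] := cert _ _ (valP x) (valP u) xu.
  by rewrite ltnNge hmax.
have px_y := p_x y; rewrite !inE eqxx orbT in px_y.
have px_z := p_x z; rewrite !inE mem_rcons mem_head !orbT in px_z.
have := px_y isT xy; rewrite px_z //; last by rewrite adj_sym.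
by case=> /val_inj zy; rewrite -zy mem_rcons mem_head in yz.
Qed.

(** Lower bounds go through this consequence of [decycling], since it passes directly to the parts
    of a cone or of a disjoint union. *)
Definition hits_triangles (G : sgraph) (S : {set G}) : Prop :=
  forall x y z : G, adj x y -> adj y z -> adj z x ->
  [|| x \in S, y \in S | z \in S].

Lemma decycling_hits_triangles (G : sgraph) (S : {set G}) :
  decycling S -> hits_triangles S.
Proof.
move=> /acyclicP dS x y z xy yz zx; apply/negPn; rewrite !negb_or.
apply/negP => /and3P[xS yS zS].
have neq u v : @adj G u v -> u != v.
  by apply: contraTneq => ->; rewrite adj_irr.
rewrite -!in_setC in xS yS zS.
suff /dS : ucycle (@adj (induced (~: S)))
  [:: exist _ x xS; exist _ y yS; exist _ z zS] by [].
rewrite /ucycle /= /induced_adj /= xy yz zx /= !inE -!val_eqE /= !negb_or.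
by rewrite !neq // adj_sym.
Qed.

(* The pair [(G, N)] encodes the rooted graph [cone N]: [G] is what remains
   once the root [None] is deleted, and [N] is the neighbourhood of the root.
   The triangles counted by [k] avoid the root, so that counts add up when
   roots are identified. *)
Definition realizes (k : nat) (b c : int) : Prop :=
  exists (G : sgraph) (N : {set G}),
    [/\ alt_sum [set: G] = b, alt_sum (~: N) = c,
        forall x, connect (@adj (cone N)) None x,
        exists (S : {set G}) p h, [/\ #|S| = k, parent_certificate S p h &
          {in ~: S, forall x, x \in N -> p x = None}] &
        forall S : {set G}, hits_triangles S -> (k <= #|S|)%N].

(** * Hanging and identifying roots *)

Lemma connect_homo (S T : finType) (e : rel S) (e' : rel T) (f : S -> T) :
  {homo f : x y / e x y >-> e' x y} ->
  {homo f : x y / connect e x y >-> connect e' x y}.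
Proof.
move=> fe x y /connectP[p ep ->{y}]; elim: p x ep => //= y p IHp x /andP[xy ep].
exact: connect_trans (connect1 (fe _ _ xy)) (IHp _ ep).
Qed.

Section ConeSets.
Variables (G : sgraph) (N : {set G}).

Lemma hits_triangles_cone (S : {set cone N}) :
  hits_triangles S -> hits_triangles [set x | Some x \in S].
Proof. by move=> hS x y z *; rewrite !inE; apply: hS. Qed.

Lemma card_cone_trace (S : {set cone N}) : (#|[set x : G | Some x \in S]| <= #|S|)%N.
Proof.
rewrite -(card_imset _ Some_inj); apply: subset_leq_card.
by apply/subsetP => _ /imsetP[x xS ->]; rewrite inE in xS.
Qed.

(** The apex enters at height 0 as the parent of the vertices of [N] outside [S]; these must be
    parentless before, so that no vertex gets two parents. *)
Lemma parent_certificate_cone (S : {set G}) p h :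
  parent_certificate S p h -> {in ~: S, forall x, x \in N -> p x = None} ->
  parent_certificate (cone_set N (false, S))
    (oapp (fun x => Some (p x)) None) (oapp (fun x => (h x).+1) 0%N).
Proof.
move=> cert pN [x|] [y|]; rewrite !inE //= -?in_setC => xS yS xy.
- by case: (cert x y xS yS xy) => -[hxy ->]; [left | right].
- by left; rewrite pN.
- by right; rewrite pN.
Qed.

End ConeSets.

Lemma realizes_cone k b c : realizes k b c -> realizes k (b - c) b.
Proof.
move=> [G [N [Gb Gc conG [S [p [h [cardS cert pN]]]] lowG]]].
exists (cone N), [set None]; split.
- by rewrite alt_sum_cone Gb Gc.
- by rewrite alt_sum_cone_apex.
- case=> [x|] //; apply: (@connect_trans _ _ (Some None)).
    by apply: connect1; rewrite /= inE.
  by apply: (@connect_homo _ _ (@adj (cone N)) _ Some).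
- exists (cone_set N (false, S)), (oapp (fun x => Some (p x)) None).
  exists (oapp (fun x => (h x).+1) 0%N); split.
  + by rewrite card_cone_set.
  + exact: parent_certificate_cone.
  + by move=> x _; rewrite inE => /eqP->.
- move=> T /hits_triangles_cone/lowG/leq_trans; apply; exact: card_cone_trace.
Qed.

Lemma realizes_merge k1 k2 b1 b2 c1 c2 :
  realizes k1 b1 c1 -> realizes k2 b2 c2 -> realizes (k1 + k2) (b1 * b2) (c1 * c2).
Proof.
move=> [G [N [Gb Gc conG [S [p [h [cardS cert pN]]]] lowG]]].
move=> [H [M [Hb Hc conH [T [r [g [cardT cert' rM]]]] lowH]]].
exists (dunion G H), (dunion_set (N, M)); split.
- rewrite -Gb -Hb -alt_sum_dunion; congr alt_sum.
  by apply/setP=> -[x|x]; rewrite !inE.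
- rewrite -Gc -Hc -alt_sum_dunion; congr alt_sum.
  by apply/setP=> -[x|x]; rewrite !inE.
- case=> [[x|x]|] //.
    (* [omap inl] embeds [cone N] in the merged graph and sends root to root. *)
    apply: (@connect_homo _ _ (@adj (cone N)) _ (omap inl) _ None (Some x)) => //.
    by move=> [u|] [v|]; rewrite /= ?inE.
  apply: (@connect_homo _ _ (@adj (cone M)) _ (omap inr) _ None (Some x)) => //.
  by move=> [u|] [v|]; rewrite /= ?inE.
- exists (dunion_set (S, T)).
  exists (fun s : G + H => match s with inl x => omap inl (p x) | inr y => omap inr (r y) end).
  exists (fun s : G + H => match s with inl x => h x | inr y => g y end); split.
  + by rewrite card_dunion_set cardS cardT.
  + move=> [x|x] [y|y]; rewrite !inE //= -!in_setC => xS yS xy.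
      by case: (cert x y xS yS xy) => -[? ->]; [left | right].
    by case: (cert' x y xS yS xy) => -[? ->]; [left | right].
  + move=> [x|x]; rewrite !inE -in_setC => xS xN.
      by rewrite pN.
    by rewrite rM.
- move=> U hU.
  have -> : U = dunion_set ([set x | inl x \in U], [set y | inr y \in U]).
    by apply/setP=> -[x|x]; rewrite !inE.
  rewrite card_dunion_set leq_add //.
    by apply: lowG => x y z *; rewrite !inE; apply: hU.
  by apply: lowH => x y z *; rewrite !inE; apply: hU.
Qed.

(** * Base cases: the single vertex and the triangle with a pendant root *)

Lemma alt_sum0 (G : sgraph) : alt_sum (set0 : {set G}) = 1.
Proof.
rewrite /alt_sum (big_pred1 set0) ?cards0 //= => A.
rewrite subset0 andbC /=; have [->|//] := eqVneq A set0; rewrite /=.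
by apply/indepP => x y; rewrite inE.
Qed.

Definition graph0 : sgraph :=
  @SGraph void (fun _ _ => false) (fun _ _ => erefl) (fun _ => erefl).

Lemma alt_sum_graph0 : alt_sum [set: graph0] = 1.
Proof. by rewrite -(alt_sum0 graph0); congr alt_sum; apply/setP => -[]. Qed.

Lemma realizes_root : realizes 0 1 1.
Proof.
exists graph0, setT; split=> //.
- exact: alt_sum_graph0.
- by rewrite setCT alt_sum0.
- by case=> // -[].
- by exists set0, (fun=> None), (fun=> 0%N); split; rewrite ?cards0 // => -[].
Qed.

Definition edge : sgraph := cone [set: cone [set: graph0]].

Lemma alt_sum_edge : alt_sum [set: edge] = -1.
Proof. by rewrite !alt_sum_cone !setCT !alt_sum0 alt_sum_graph0. Qed.

Lemma realizes_triangle : realizes 1 (- 2) (-1).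
Proof.
exists (cone [set: edge]), [set None]; split.
- by rewrite alt_sum_cone alt_sum_edge setCT alt_sum0.
- by rewrite alt_sum_cone_apex alt_sum_edge.
- have root_apex : connect (@adj (cone [set None : cone [set: edge]]))
      None (Some None) by apply: connect1; rewrite /= inE.
  case=> [[x|]|] //; apply: connect_trans root_apex _.
  by apply: connect1; rewrite /= inE.
(* Removing one end of [edge] leaves two vertices of the triangle, with [None], the neighbour of the
   root, as the parentless one. *)
- exists [set Some None].
  exists (fun x => if x is Some _ then Some None else None).
  exists (fun x => if x is Some _ then 1%N else 0%N); split.
  + by rewrite cards1.
  + by move=> [[[[]|]|]|] [[[[]|]|]|]; rewrite !inE //= => _ _ _; [left|right].
  + by move=> x _; rewrite inE => /eqP->.
- move=> S hS; rewrite card_gt0; apply/set0Pn.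
  have [] : [|| None \in S, Some None \in S | Some (Some None) \in S].
    by apply: hS; rewrite /= ?inE.
  by case/or3P => ?; eexists; eassumption.
Qed.

(** * Realizing all values *)

Lemma realizes_opp k b c : realizes k b c -> realizes k (- b) (- c).
Proof.
move=> /realizes_cone/realizes_cone/realizes_cone.
(* The pairs are [(b, c)], [(b - c, b)], [(- c, b - c)], [(- b, - c)]. *)
by congr realizes; ring.
Qed.

Lemma realizes_nat k m : (m < 2 ^ k)%N -> realizes k m%:Z (-1).
Proof.
elim: k m => [|k IHk] m ltm.
  have -> : m = 0%N by lia.
  (* From [(1, 1)] to [(0, 1)], then to [(0, -1)]. *)
  exact: realizes_opp (realizes_cone realizes_root).
have /IHk/realizes_opp m2 : (m./2 < 2 ^ k)%N by rewrite expnS in ltm; lia.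
have := odd_double_half m; case: odd => /= [def_m | def_m].
  (* Let [n = m./2], so [m2] realizes [(- n, 1)]. The factors are [(1, n + 1)] and [(-1, -2)];
     hanging their product [(-1, - 2 * (n + 1))] gives [(2 * n + 1, -1)]. *)
  have := realizes_merge (realizes_opp (realizes_cone (realizes_cone m2)))
    (realizes_cone realizes_triangle).
  by move/realizes_cone; rewrite addn1; congr realizes; lia.
(* Here [(- n, 1)] times [(-2, -1)] is [(2 * n, -1)]. *)
have := realizes_merge m2 realizes_triangle.
by rewrite addn1; congr realizes; lia.
Qed.

Lemma realizes_graph k b c : realizes k b c ->
  exists G : sgraph,
    [/\ connected G, decycling_number G = k & (indep_poly G).[-1] = b - c].
Proof.
move=> [G [N [Gb Gc conG [S [p [h [cardS cert pN]]]] lowG]]].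
exists (cone N); split.
- split; first by apply/card_gt0P; exists None.
  move=> x y; apply: connect_trans (conG y).
  by rewrite (sym_connect_sym (@adj_sym (cone N))).
- apply/decycling_numberP; split.
    exists (cone_set N (false, S)); last by rewrite card_cone_set.
    exact: decycling_parent (parent_certificate_cone cert pN).
  move=> T /decycling_hits_triangles/hits_triangles_cone/lowG/leq_trans; apply.
  exact: card_cone_trace.
- by rewrite indep_poly_at_m1 alt_sum_cone Gb Gc.
Qed.

Theorem theorem2p6 (k : nat) (q : int) :
  (0 < k)%N -> `|q| <= 2 ^+ k ->
  exists G : sgraph,
    [/\ connected G, decycling_number G = k & (indep_poly G).[-1] = q].
Proof.
move=> _ leq; have {}leq : (`|q|%N <= 2 ^ k)%N by rewrite -natrX natz in leq.
(* The pair [(m, -1)] has value [m + 1], so [m] is [|q| - 1] for nonzero [q], and a negative [q]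
   takes the opposite pair. *)
have [q0|q0] := ltrP 0 q.
  have /realizes_nat/realizes_graph : (`|q|.-1 < 2 ^ k)%N by lia.
  by have -> : `|q|.-1%:Z - -1 = q by lia.
have [->|qn0] := eqVneq q 0.
  (* Two hangings lead from [(0, -1)] through [(1, 0)] to [(1, 1)], of value 0. *)
  have /realizes_nat := expn_gt0 2 k.
  by move=> /realizes_cone/realizes_cone/realizes_graph.
have /realizes_nat/realizes_opp/realizes_graph : (`|q|.-1 < 2 ^ k)%N by lia.
by have -> : - (`|q|.-1%:Z) - - -1 = q by lia.
Qed.
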